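(* Let $\mathbb{K}$ be a field, $r\in\mathbb{K}$ invertible and $q:=r-1$. For each partition diagram $\pi$ let $\eta^{(q)}_\pi:=\sum_{\sigma\ge\pi}r^{l(\sigma)}M_\sigma$ and $L_\pi:=\sum_{\sigma\le\pi}M_\sigma$ in $\mathrm{ParQSym}$. Then: (1) for any partition diagram $\pi$, $$\eta^{(q)}_\pi=r\sum_{\rho:\ \rho\sim\pi}(-1)^{|S(\rho)\setminus S(\pi)|}q^{|S(\rho)\cap S(\pi)|}L_\rho;$$ (2) for any $\pi\in I_n$, $$L_\pi=r^{-n}\sum_{\rho:\ \rho\sim\pi}(-1)^{|S(\pi)\setminus S(\rho)|}q^{|[n-1]\setminus(S(\rho)\cup S(\pi))|}\eta^{(q)}_\rho.$$
   Context: Conventions: $q^0=1$ (also if $q=0$); $[m]=\{1,\dots,m\}$, which is empty for $m\le0$. **Partition diagrams.** A partition diagram of order $k\ge 0$ is a set partition of $\{1,\dots,k,1',\dots,k'\}$; for $k=0$ the only one is the empty diagram $\emptyset$. For $\pi$ of order $k$ and $\rho$ of order $m$, $\pi\otimes\rho$ is the diagram of order $k+m$ whose blocks are the blocks of $\pi$ and the blocks of $\rho$ with labels shifted by $k$ ($i\mapsto i+k$, $i'\mapsto (i+k)'$). If $k,m\ge1$, $\pi\bullet\rho$ is obtained from $\pi\otimes\rho$ by merging the block containing $k'$ with the block containing $(k+1)'$. The empty diagram is the unit for both operations. A diagram is $\otimes$-irreducible (resp. $\bullet$-irreducible) if it is not $\rho\otimes\sigma$ (resp. $\rho\bullet\sigma$)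 with $\rho,\sigma$ both non-empty. Every non-empty $\pi$ is uniquely $\pi_1\otimes\cdots\otimes\pi_l$ with all $\pi_i$ non-empty and $\otimes$-irreducible; $l(\pi):=l$, and $l(\emptyset):=0$. **Refinement.** Every non-empty $\pi$ can be uniquely written $\pi=\pi_1\divideontimes_1\pi_2\divideontimes_2\cdots\divideontimes_{n-1}\pi_n$ with each $\divideontimes_i\in\{\otimes,\bullet\}$ and each $\pi_i$ non-empty and both $\otimes$- and $\bullet$-irreducible (on non-empty diagrams $\otimes$ and $\bullet$ associate with each other). $I_n$ ($n\ge1$) is the set of diagrams with exactly $n$ such factors, and $I_0=\{\emptyset\}$. Put $S(\pi)=\{i\in[n-1]:\divideontimes_i=\otimes\}$, and $S(\emptyset)=\varnothing$. For non-empty $\pi,\sigma$ write $\pi\sim\sigma$ if their sequences $(\pi_1,\dots,\pi_n)$ and $(\sigma_1,\dots,\sigma_m)$ are equal; $\pi\le\sigma$ if $\pi\sim\sigma$ and $S(\sigma)\subseteq S(\pi)$. The empty diagram is related only to itself, with $\emptyset\sim\emptyset$ and $\emptyset\le\emptyset$. **ParQSym** is the $\mathbb{K}$-vector space with basis $\{M_\pi\}$ indexed by all partition diagrams.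
   Formalization: Part (1) is stated only for non-empty partition diagrams π: at π = ∅ the printed formula would read M_∅ = r·M_∅, since l(∅) = 0, which fails whenever r ≠ 1. Part (2) is unchanged. *)

(* Defs.v *)
From mathcomp Require Import all_boot all_order all_algebra finmap.
From mathcomp Require Import boolp classical_sets cardinality fsbigop.
From mathcomp Require Import finset monalg.

Set Implicit Arguments.
Unset Strict Implicit.
Unset Printing Implicit Defensive.

Import GRing.Theory.

Local Open Scope ring_scope.

(** [inl i] is the vertex i+1 and [inr i] is the vertex (i+1)'. *)
Definition vertex (k : nat) : finType := ('I_k + 'I_k)%type.

Definition is_diagram k (P : {set {set vertex k}}) : bool :=
  partition P [set: vertex k]%SET.

Definition diagram (k : nat) : finType := {P : {set {set vertex k}} | is_diagram P}.

(** Partition diagrams of all orders; [tag pi] is the order of [pi]. *)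
Definition pdiagram : choiceType := {k : nat & diagram k}.

Definition mk_pdiagram k P (hP : @is_diagram k P) : pdiagram :=
  Tagged diagram (exist (@is_diagram k) P hP).

Definition lvertex k m (v : vertex k) : vertex (k + m) :=
  match v with inl i => inl (lshift m i) | inr i => inr (lshift m i) end.

Definition rvertex k m (v : vertex m) : vertex (k + m) :=
  match v with inl i => inl (rshift k i) | inr i => inr (rshift k i) end.

Lemma lvertex_inj k m : injective (@lvertex k m).
Proof. by move=> [i|i] [j|j] //= [] /val_inj ->. Qed.

Lemma rvertex_inj k m : injective (@rvertex k m).
Proof. by move=> [i|i] [j|j] //= [] /addnI /val_inj ->. Qed.

Lemma lrvertex_neq k m (u : vertex k) (v : vertex m) :
  lvertex m u <> rvertex k v.
Proof.
by case: u v => [i|i] [j|j] //= [] e;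
  have := ltn_ord i; rewrite e -ltn_subRL subnn.
Qed.

Lemma vertexP k m (v : vertex (k + m)) :
  (exists u, v = lvertex m u) \/ (exists u, v = rvertex k u).
Proof.
case: v => i; case: (split_ordP i) => j ->.
- by left; exists (inl j).
- by right; exists (inl j).
- by left; exists (inr j).
- by right; exists (inr j).
Qed.

Definition tensor_blocks k m (P : {set {set vertex k}})
    (Q : {set {set vertex m}}) : {set {set vertex (k + m)}} :=
  ([set @lvertex k m @: B | B : {set vertex k} in P]
   :|: [set @rvertex k m @: B | B : {set vertex m} in Q])%SET.

Lemma tensor_blocksP k m (P : {set {set vertex k}}) (Q : {set {set vertex m}}) :
  is_diagram P -> is_diagram Q -> is_diagram (tensor_blocks P Q).
Proof.
have injL := @lvertex_inj k m; have injR := @rvertex_inj k m.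
have disj (A : {set vertex k}) (B : {set vertex m}) :
    [disjoint (@lvertex k m @: A) & (@rvertex k m @: B)].
  rewrite -setI_eq0; apply/eqP/setP => v; rewrite !inE.
  apply/negP => /andP[/imsetP[u _ ->] /imsetP[w _]].
  exact: lrvertex_neq.
move=> /and3P[/eqP cP /trivIsetP tP nP] /and3P[/eqP cQ /trivIsetP tQ nQ].
apply/and3P; split.
- apply/eqP/setP => v; rewrite inE; apply/bigcupP.
  case: (vertexP v) => -[u ->].
  + have: u \in cover P by rewrite cP inE.
    case/bigcupP => B BP uB; exists (@lvertex k m @: B); last exact: imset_f.
    by rewrite inE imset_f.
  + have: u \in cover Q by rewrite cQ inE.
    case/bigcupP => B BQ uB; exists (@rvertex k m @: B); last exact: imset_f.
    by rewrite inE orbC imset_f.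
- apply/trivIsetP => A B; rewrite !inE.
  case/orP => /imsetP[A' A'P ->] /orP[] /imsetP[B' B'P ->] neq //.
  + rewrite (imset_disjoint injL); apply: tP => //.
    by apply: contra neq => /eqP ->.
  + by rewrite disjoint_sym.
  + rewrite (imset_disjoint injR); apply: tQ => //.
    by apply: contra neq => /eqP ->.
- rewrite inE negb_or; apply/andP; split; apply/imsetP => -[B BP] /esym/eqP.
  + by rewrite imset_eq0 => /eqP B0; rewrite -B0 BP in nP.
  + by rewrite imset_eq0 => /eqP B0; rewrite -B0 BP in nQ.
Qed.

Definition merge_blocks (T : finType) (P : {set {set T}}) (x y : T) :
    {set {set T}} :=
  let A := pblock P x in let B := pblock P y in
  ((A :|: B) |: (P :\ A :\ B))%SET.

Lemma merge_blocksP (T : finType) (P : {set {set T}}) (x y : T) :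
  partition P [set: T]%SET ->
  partition (merge_blocks P x y) [set: T]%SET.
Proof.
move=> /and3P[/eqP cP tP nP].
have xP : pblock P x \in P by rewrite pblock_mem // cP inE.
have yP : pblock P y \in P by rewrite pblock_mem // cP inE.
have x_in : x \in pblock P x by rewrite mem_pblock cP inE.
rewrite /merge_blocks; set A := pblock P x in xP x_in *.
set B := pblock P y in yP *.
have [{}tP tP'] := (elimT trivIsetP tP, tP).
have dis C : C \in (P :\ A :\ B)%SET -> [disjoint (A :|: B)%SET & C].
  rewrite !inE => /and3P[CB CA CP].
  by rewrite -setI_eq0 setIUl setU_eq0 !setI_eq0 !tP // eq_sym.
apply/and3P; split.
- apply/eqP/setP => v; rewrite inE; apply/bigcupP.
  have: v \in cover P by rewrite cP inE.
  case/bigcupP => C CP vC.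
  have [CA|CA] := eqVneq C A.
    by exists (A :|: B)%SET; rewrite ?inE ?eqxx // -CA vC.
  have [CB|CB] := eqVneq C B.
    by exists (A :|: B)%SET; rewrite ?inE ?eqxx // -CB vC orbT.
  by exists C => //; rewrite !inE CA CB CP !orbT.
- apply/trivIsetP => C D; rewrite !(in_setU1 _ (A :|: B)%SET).
  case/predU1P => [->|CP] /predU1P[->|DP]; rewrite ?eqxx // => neq.
  + exact: dis.
  + by rewrite disjoint_sym; exact: dis.
  + by move: CP DP; rewrite !inE => /and3P[_ _ ?] /and3P[_ _ ?]; exact: tP.
- rewrite in_setU1 !in_setD1 (negPf nP) !andbF orbF eq_sym setU_eq0.
  apply/negP => /andP[/eqP A0 _].
  by rewrite A0 inE in x_in.
Qed.

Lemma empty_blocksP : is_diagram (set0 : {set {set vertex 0}}).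
Proof.
apply/and3P; split; last by rewrite inE.
- by apply/eqP/setP => -[[]|[]].
- by apply/trivIsetP => A B; rewrite inE.
Qed.

Definition empty_diagram : pdiagram := mk_pdiagram empty_blocksP.

Definition tensor (pi rho : pdiagram) : pdiagram :=
  mk_pdiagram (tensor_blocksP (valP (tagged pi)) (valP (tagged rho))).

Definition bullet (pi rho : pdiagram) : pdiagram :=
  match pi, rho with
  | existT 0 _, _ => rho
  | _, existT 0 _ => pi
  | existT k.+1 P, existT m.+1 Q =>
    mk_pdiagram
      (merge_blocksP (T := vertex (k.+1 + m.+1))
         (inr (lshift m.+1 (@ord_max k))) (inr (rshift k.+1 (@ord0 m)))
         (tensor_blocksP (valP P) (valP Q)))
  end.

Definition tensor_irreducible (pi : pdiagram) : Prop :=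
  ~ exists rho sigma, [/\ rho <> empty_diagram, sigma <> empty_diagram
                        & pi = tensor rho sigma].

Definition bullet_irreducible (pi : pdiagram) : Prop :=
  ~ exists rho sigma, [/\ rho <> empty_diagram, sigma <> empty_diagram
                        & pi = bullet rho sigma].

Definition tensor_factorization (pi : pdiagram) (s : seq pdiagram) : Prop :=
  (forall rho, rho \in s -> rho <> empty_diagram /\ tensor_irreducible rho) /\
  pi = foldr tensor empty_diagram s.

(** Every diagram has exactly one factorization, so that the default value of
    [xget] is irrelevant; the factorization of [empty_diagram] is [[::]]. *)
Definition tensor_length (pi : pdiagram) : nat :=
  size (xget [::] [set s | tensor_factorization pi s]%classic).

(** An operation is encoded by a boolean: [true] is [tensor], [false] is
    [bullet]. *)
Definition op (b : bool) : pdiagram -> pdiagram -> pdiagram :=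
  if b then tensor else bullet.

(** The value of [s_1 op_1 s_2 op_2 ... op_(n-1) s_n], and [empty_diagram] if
    [n = 0]. *)
Definition op_product (s : seq pdiagram) (ops : seq bool) : pdiagram :=
  if s is x :: s' then foldl (fun rho c => op c.1 rho c.2) x (zip ops s')
  else empty_diagram.

Definition refinement (pi : pdiagram) (w : seq pdiagram * seq bool) : Prop :=
  [/\ forall rho, rho \in w.1 ->
        [/\ rho <> empty_diagram, tensor_irreducible rho
          & bullet_irreducible rho],
      size w.2 = (size w.1).-1
    & pi = op_product w.1 w.2].

(** Every diagram has exactly one refinement, so that the default value of
    [xget] is irrelevant; the refinement of [empty_diagram] is [([::], [::])]. *)
Definition refine (pi : pdiagram) : seq pdiagram * seq bool :=
  xget ([::], [::]) [set w | refinement pi w]%classic.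

Definition factors (pi : pdiagram) : seq pdiagram := (refine pi).1.

Definition in_I (n : nat) (pi : pdiagram) : Prop := size (factors pi) = n.

(** The set [[m]] of the integers from 1 to [m]. *)
Definition interval1 (m : nat) : {fset nat} := [fset i in iota 1 m]%fset.

(** The operation number [i] is at index [i.-1] of the list. *)
Definition tensor_set (pi : pdiagram) : {fset nat} :=
  [fset i in interval1 (size (factors pi)).-1
    | nth false (refine pi).2 i.-1]%fset.

Definition sim (pi sigma : pdiagram) : Prop := factors pi = factors sigma.

Definition refines (pi sigma : pdiagram) : Prop :=
  sim pi sigma /\ (tensor_set sigma `<=` tensor_set pi)%fset.

Notation ParQSym K := {malg K[pdiagram]}.

Definition M_basis (K : fieldType) (pi : pdiagram) : ParQSym K := << 1 *g pi >>.

(** The sums [\sum_(_ \in _)] below are over finite sets, since related diagrams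
    have the same order; no junk value of the notation is involved. *)

(** This is eta^(q) with q = r - 1. *)
Definition eta (K : fieldType) (r : K) (pi : pdiagram) : ParQSym K :=
  \sum_(sigma \in [set sigma | refines pi sigma]%classic)
    r ^+ tensor_length sigma *: M_basis K sigma.

Definition L_basis (K : fieldType) (pi : pdiagram) : ParQSym K :=
  \sum_(sigma \in [set sigma | refines sigma pi]%classic) M_basis K sigma.

(* Main.v *)
Require Import Defs.
From mathcomp Require Import all_boot all_order all_algebra finmap.
From mathcomp Require Import boolp classical_sets cardinality fsbigop.
From mathcomp Require Import finset monalg zify ring.

Import GRing.Theory.
Local Open Scope ring_scope.

Set Implicit Arguments.
Unset Strict Implicit.
Unset Printing Implicit Defensive.

(** Whether a diagram splits as [rho op sigma] with [rho] of order [i] can be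
    read off its blocks: for [tensor] no block crosses the cut after column [i],
    for [bullet] exactly one does and it contains [i'] and [(i+1)']. Hence the
    operation at a cut and both factors are determined, and two cuts of the same
    diagram interpolate (Levi's lemma). This gives unique factorizations, so
    that the diagrams similar to [pi] in [I_n] are indexed by the maps
    [f : [n-1] -> bool], and [tensor_length] is 1 plus the number of tensors.

    The transition matrices between [M], [L] and [eta] on such a class are
    (up to powers of [r]) tensor powers of 2x2 matrices, one factor for each
    position of [[n-1]], so that both formulas reduce to identities between
    2x2 matrices. *)

(** * Set partitions as relations *)

Definition joined (T : finType) (P : {set {set T}}) (u v : T) : bool :=
  [exists B in P, (u \in B) && (v \in B)].

Lemma joinedP (T : finType) (P : {set {set T}}) (u v : T) :
  reflect (exists2 B, B \in P & (u \in B) /\ (v \in B)) (joined P u v).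
Proof.
apply: (iffP existsP) => [[B /and3P[? ? ?]]|[B ? [? ?]]]; exists B => //.
exact/and3P.
Qed.

Lemma joined_sym (T : finType) (P : {set {set T}}) u v :
  joined P u v = joined P v u.
Proof. by apply/joinedP/joinedP => -[B BP []]; exists B. Qed.

Lemma joined_trans (T : finType) (P : {set {set T}}) :
  trivIset P -> transitive (joined P).
Proof.
move=> /trivIsetP tP v u w /joinedP[B BP [uB vB]] /joinedP[C CP [vC wC]].
apply/joinedP; exists B => //; split=> //.
have [-> //|/(tP _ _ BP CP)] := eqVneq B C.
by move/disjoint_setI0/setP/(_ v); rewrite !inE vB vC.
Qed.

Lemma joined_refl (T : finType) (P : {set {set T}}) :
  cover P = [set: T]%SET -> reflexive (joined P).
Proof.
move=> cP u; have: u \in cover P by rewrite cP inE.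
by case/bigcupP => B BP uB; apply/joinedP; exists B.
Qed.

Lemma joined_pblock (T : finType) (P : {set {set T}}) u v :
  partition P [set: T]%SET -> joined P u v = (v \in pblock P u).
Proof.
case/and3P => /eqP cP tP nP; apply/joinedP/idP => [[B BP [uB vB]]|uv].
  by rewrite (def_pblock tP BP uB).
by exists (pblock P u); rewrite ?pblock_mem ?mem_pblock ?cP ?inE.
Qed.

(** A block of a partition is non-empty, hence it is the class of any of its points, and the class
    can be read off [joined]. *)
Lemma eq_joined (T : finType) (P Q : {set {set T}}) :
  partition P [set: T]%SET -> partition Q [set: T]%SET ->
  joined P =2 joined Q -> P = Q.
Proof.
have sub (A B : {set {set T}}) : partition A [set: T]%SET ->
    partition B [set: T]%SET -> joined A =2 joined B -> A \subset B.
  move=> pA pB eqAB; apply/fintype.subsetP => C CA.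
  have [/and3P[_ tA nA] /and3P[/eqP cB _ _]] := (pA, pB).
  have /set0Pn[u uC] : C != set0 by apply: contraNneq nA => <-.
  suff -> : C = pblock B u by rewrite pblock_mem // cB inE.
  apply/setP => v; rewrite -(joined_pblock _ _ pB) -eqAB joined_pblock //.
  by rewrite (def_pblock tA CA uC).
by move=> pP pQ eqPQ; apply/eqP; rewrite eqEsubset !sub // => u v; rewrite eqPQ.
Qed.

Lemma joined_tensor_ll k m (P : {set {set vertex k}}) (Q : {set {set vertex m}})
    u v :
  joined (tensor_blocks P Q) (lvertex m u) (lvertex m v) = joined P u v.
Proof.
apply/joinedP/joinedP => [[B]|[B BP [uB vB]]].
  rewrite inE => /orP[]/imsetP[C CP ->]; last first.
    by case=> /imsetP[w _ /lrvertex_neq].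
  by rewrite !(mem_imset _ _ (@lvertex_inj k m)) => ?; exists C.
by exists (@lvertex k m @: B)%SET; rewrite ?inE ?imset_f.
Qed.

Lemma joined_tensor_rr k m (P : {set {set vertex k}}) (Q : {set {set vertex m}})
    u v :
  joined (tensor_blocks P Q) (rvertex k u) (rvertex k v) = joined Q u v.
Proof.
apply/joinedP/joinedP => [[B]|[B BP [uB vB]]].
  rewrite inE => /orP[]/imsetP[C CP ->].
    by case=> /imsetP[w _ /esym/lrvertex_neq].
  by rewrite !(mem_imset _ _ (@rvertex_inj k m)) => ?; exists C.
by exists (@rvertex k m @: B)%SET; rewrite ?inE ?imset_f ?orbT.
Qed.

Lemma joined_tensor_lr k m (P : {set {set vertex k}}) (Q : {set {set vertex m}})
    u v :
  joined (tensor_blocks P Q) (lvertex m u) (rvertex k v) = false.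
Proof.
apply/joinedP => -[B]; rewrite inE => /orP[]/imsetP[C CP ->] [].
  by move=> _ /imsetP[w _ /esym/lrvertex_neq].
by move=> /imsetP[w _ /lrvertex_neq].
Qed.

(** Merging adds one link between [x] and [y], and a connection needs it at most once; the last two
    disjuncts are its two directions. The case where [x] and [y] already share a block is
    included. *)
Lemma joined_merge (T : finType) (P : {set {set T}}) (x y u v : T) :
  partition P [set: T]%SET ->
  joined (merge_blocks P x y) u v =
  [|| joined P u v, joined P u x && joined P y v
    | joined P u y && joined P x v].
Proof.
move=> pP; have pM := merge_blocksP x y pP.
have [/and3P[/eqP cP tP nP] /and3P[/eqP cM tM nM]] := (pP, pM).
have trM := joined_trans tM.
have xy : joined (merge_blocks P x y) x y.
  apply/joinedP; exists (pblock P x :|: pblock P y)%SET.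
    by rewrite in_setU1 eqxx.
  by rewrite !inE !mem_pblock cP !inE orbT.
have sub s t : joined P s t -> joined (merge_blocks P x y) s t.
  case/joinedP => B BP [sB tB].
  have [eB|nB] := boolP ((B == pblock P x) || (B == pblock P y)).
    apply/joinedP; exists (pblock P x :|: pblock P y)%SET.
      by rewrite in_setU1 eqxx.
    by rewrite !inE; case/orP: eB => /eqP <-; rewrite sB tB ?orbT.
  apply/joinedP; exists B => //; move: nB; rewrite negb_or => /andP[n1 n2].
  by rewrite in_setU1 !in_setD1 n1 n2 BP orbT.
apply/idP/idP => [/joinedP[B]|].
  rewrite in_setU1 !in_setD1 => /predU1P[->|/and3P[_ _ BP]] [uB vB]; last first.
    by apply/orP; left; apply/joinedP; exists B.
  move: uB vB; rewrite !inE -!joined_pblock // ![joined P _ u]joined_sym.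
  have trP := joined_trans tP.
  case/orP => u1 /orP[] v1; rewrite ?u1 ?v1 ?orbT //=.
    by rewrite (trP _ _ _ u1 v1).
  by rewrite (trP _ _ _ u1 v1).
case/or3P => [/sub //|/andP[/sub a /sub b]|/andP[/sub a /sub b]].
  exact: trM a (trM _ _ _ xy b).
by apply: trM a (trM _ _ _ _ b); rewrite joined_sym.
Qed.

(** * Diagrams on a common set of points *)

(** A vertex [i+1] (resp. [(i+1)']) of any diagram is the point [(i, false)]
    (resp. [(i, true)]), so that diagrams of different orders live on the same
    points. *)
Definition point : Type := (nat * bool)%type.

Definition point_of k (v : vertex k) : point :=
  match v with inl i => (val i, false) | inr i => (val i, true) end.

Definition shift (k : nat) (x : point) : point := (k + x.1, x.2)%N.

Definition degree (pi : pdiagram) : nat := tag pi.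

(** Points beyond the order of [pi] are connected to nothing, not even to themselves. *)
Definition conn (pi : pdiagram) (x y : point) : bool :=
  [exists B in val (tagged pi),
     (x \in [seq point_of v | v in B]) && (y \in [seq point_of v | v in B])].

Lemma point_of_inj k : injective (@point_of k).
Proof. by move=> [i|i] [j|j] //= [] /val_inj ->. Qed.

Lemma point_of_lt k (v : vertex k) : ((point_of v).1 < k)%N.
Proof. by case: v => i /=. Qed.

Lemma point_ofP k (x : point) : (x.1 < k)%N -> exists v : vertex k, x = point_of v.
Proof.
case: x => i [] /= ik; first by exists (inr (Ordinal ik)).
by exists (inl (Ordinal ik)).
Qed.

Lemma point_of_lvertex k m (v : vertex k) : point_of (lvertex m v) = point_of v.
Proof. by case: v. Qed.

Lemma point_of_rvertex k m (v : vertex m) :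
  point_of (rvertex k v) = shift k (point_of v).
Proof. by case: v. Qed.

Lemma conn_point (pi : pdiagram) (u v : vertex (degree pi)) :
  conn pi (point_of u) (point_of v) = joined (val (tagged pi)) u v.
Proof.
by apply: eq_existsb => B; rewrite !(fintype.mem_image (@point_of_inj _)).
Qed.

Lemma conn_lt pi x y : conn pi x y -> (x.1 < degree pi)%N /\ (y.1 < degree pi)%N.
Proof.
case/existsP => B /and3P[_ /fintype.imageP[u _ ->] /fintype.imageP[v _ ->]].
by split; apply: point_of_lt.
Qed.

Lemma conn_sym pi x y : conn pi x y = conn pi y x.
Proof. by apply: eq_existsb => B; congr andb; rewrite andbC. Qed.

Lemma blocksP (pi : pdiagram) : partition (val (tagged pi)) [set: _]%SET.
Proof. exact: valP (tagged pi). Qed.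

Lemma conn_refl pi x : conn pi x x = (x.1 < degree pi)%N.
Proof.
apply/idP/idP => [/conn_lt[]//|/point_ofP[v ->]].
rewrite conn_point joined_refl //.
by have /and3P[/eqP] := blocksP pi.
Qed.

Lemma conn_trans pi : transitive (conn pi).
Proof.
move=> y x z xy yz; have [xk yk] := conn_lt xy; have [_ zk] := conn_lt yz.
case: (point_ofP xk) (point_ofP yk) (point_ofP zk) => u eu [v ev] [w ew].
move: xy yz; rewrite eu ev ew !conn_point; apply: joined_trans.
by have /and3P[] := blocksP pi.
Qed.

(** Since points do not depend on the order, diagrams are compared without transport along the
    equality of their orders. *)
Lemma pdiagram_ext (pi rho : pdiagram) :
  degree pi = degree rho ->
  (forall x y, (x.1 < degree pi)%N -> (y.1 < degree pi)%N ->
     conn pi x y = conn rho x y) ->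
  pi = rho.
Proof.
case: pi rho => [k P] [m Q] /= e; rewrite /degree /= in e; subst m => eqc.
congr existT; apply: val_inj; apply: eq_joined.
- exact: valP P.
- exact: valP Q.
move=> u v; have := eqc (point_of u) (point_of v) (point_of_lt u) (point_of_lt v).
by rewrite (@conn_point (Tagged diagram P)) (@conn_point (Tagged diagram Q)).
Qed.

Lemma degree_eq0 pi : degree pi = 0%N -> pi = empty_diagram.
Proof. by move=> e; apply: pdiagram_ext => // x y; rewrite e. Qed.

Lemma degree_gt0 pi : pi <> empty_diagram <-> (0 < degree pi)%N.
Proof.
split=> [ne|lt0 e]; last by rewrite e in lt0.
by rewrite lt0n; apply/eqP => /degree_eq0.
Qed.

Lemma degree_op a rho sigma : degree (op a rho sigma) = (degree rho + degree sigma)%N.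
Proof. by case: a rho sigma => [] [[|k] P] [[|m] Q] //=; rewrite addn0. Qed.


(** * Connections in a product *)

Definition unshift (k : nat) (x : point) : point := (x.1 - k, x.2)%N.

Lemma shiftK k : cancel (shift k) (unshift k).
Proof. by case=> i b; rewrite /shift /unshift /= addKn. Qed.

Lemma unshiftK k x : (k <= x.1)%N -> shift k (unshift k x) = x.
Proof. by case: x => i b /= ki; rewrite /shift /unshift /= subnKC. Qed.

Lemma conn_geF pi x y : (degree pi <= x.1)%N || (degree pi <= y.1)%N ->
  conn pi x y = false.
Proof.
by apply: contraTF => /conn_lt[xk yk]; rewrite negb_or -!ltnNge xk yk.
Qed.

Lemma conn_tensor rho sigma x y :
  conn (tensor rho sigma) x y =
  if (x.1 < degree rho)%N then (y.1 < degree rho)%N && conn rho x y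
  else (degree rho <= y.1)%N &&
    conn sigma (unshift (degree rho) x) (unshift (degree rho) y).
Proof.
set k := degree rho; set m := degree sigma.
have ord : degree (tensor rho sigma) = (k + m)%N by [].
(* Beyond the last column both sides are false; elsewhere the points come from vertices, on the left
   or on the right. *)
have [/orP xy|] := boolP ((k + m <= x.1)%N || (k + m <= y.1)%N).
  rewrite conn_geF; last by apply/orP.
  symmetry; case: ltnP => /= xk.
    by apply/negP => /andP[_ /conn_lt[]]; rewrite -/k; lia.
  by apply/negP => /andP[yk /conn_lt[]] /=; rewrite -/m; lia.
rewrite negb_or -!ltnNge => /andP[/point_ofP[u ->] /point_ofP[v ->]].
rewrite (@conn_point (tensor rho sigma)) /=.
case: (vertexP u) => -[{}u ->]; case: (vertexP v) => -[{}v ->];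
  rewrite ?point_of_lvertex ?point_of_rvertex /= ?point_of_lt ?shiftK
    ?ltnNge ?leq_addr //=.
- by rewrite joined_tensor_ll conn_point.
- exact: joined_tensor_lr.
- by rewrite leqNgt point_of_lt joined_sym joined_tensor_lr.
- by rewrite joined_tensor_rr conn_point.
Qed.

(** One formula serves both operations: the sides can only be linked through the last primed vertex
    of [rho] and the first one of [sigma], and this link is present exactly for [bullet]. *)
Lemma conn_op a rho sigma x y : (0 < degree rho)%N -> (0 < degree sigma)%N ->
  let k := degree rho in
  conn (op a rho sigma) x y =
  if (x.1 < k)%N then
    if (y.1 < k)%N then conn rho x y
    else [&& ~~ a, conn rho x (k.-1, true) & conn sigma (0%N, true) (unshift k y)]
  else
    if (y.1 < k)%N then
      [&& ~~ a, conn rho y (k.-1, true) & conn sigma (0%N, true) (unshift k x)]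
    else conn sigma (unshift k x) (unshift k y).
Proof.
move=> k0 m0 k; case: a => /=.
  by rewrite conn_tensor -/k; case: (ltnP x.1) => xk; case: (ltnP y.1).
(* This is [joined_merge] for the tensor product, carried over to points; it remains true out of
   range, where both sides vanish. *)
have -> : conn (bullet rho sigma) x y =
    [|| conn (tensor rho sigma) x y,
      conn (tensor rho sigma) x (k.-1, true) &&
      conn (tensor rho sigma) (k, true) y
    | conn (tensor rho sigma) x (k, true) &&
      conn (tensor rho sigma) (k.-1, true) y].
  have [xy|] := boolP ((k + degree sigma <= x.1) || (k + degree sigma <= y.1))%N.
    have et : degree (tensor rho sigma) = (k + degree sigma)%N by [].
    rewrite conn_geF ?(degree_op false) //; case/orP: xy => h.
      by rewrite !(@conn_geF _ x) ?et ?h.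
    by rewrite !(@conn_geF _ _ y) ?et ?h ?orbT // !andbF.
  rewrite negb_or -!ltnNge => /andP[xl yl].
  rewrite /k in xl yl *; clear k.
  case: rho sigma k0 m0 xl yl => [[|k] P] [[|m] Q] //= _ _.
  rewrite /degree /= => /point_ofP[u ->] /point_ofP[v ->].
  set t := tensor _ _.
  have e1 : (k, true) =
      point_of (inr (lshift m.+1 (@ord_max k)) : vertex (k.+1 + m.+1)) by [].
  have e2 : (k.+1, true) =
      point_of (inr (rshift k.+1 (@ord0 m)) : vertex (k.+1 + m.+1)).
    by rewrite /= addn0.
  rewrite e1 e2 !(@conn_point t) (@conn_point (mk_pdiagram _)) /=.
  rewrite joined_merge //.
  exact: blocksP t.
rewrite !conn_tensor -/k /= /unshift /= leqnn subnn prednK // ltnn.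
case: (ltnP x.1) => xk; case: (ltnP y.1) => yk //=;
  rewrite ?leqnn ?leq_pred /= ?orbF ?andbF //=.
- by rewrite orbF.
- by rewrite conn_sym andbC (conn_sym rho).
- have -> : (k <= k.-1)%N = false by lia.
  by rewrite /= !orbF.
Qed.

(** * Cuts of a diagram *)

(** The window of [pi] formed by consecutive columns after column [i], as many as the order of
    [tau]. *)
Definition restr (i : nat) (pi tau : pdiagram) : Prop :=
  (i + degree tau <= degree pi)%N /\
  forall x y, (x.1 < degree tau)%N -> (y.1 < degree tau)%N ->
    conn tau x y = conn pi (shift i x) (shift i y).

Definition cut (a : bool) (i : nat) (pi : pdiagram) : Prop :=
  forall x y, (x.1 < i)%N -> (i <= y.1)%N -> (y.1 < degree pi)%N ->
    conn pi x y = [&& ~~ a, conn pi x (i.-1, true) & conn pi (i, true) y].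

(** The blocks of the window are the classes of [conn pi] pulled back to it. The bound on [i + m]
    makes that relation reflexive. *)
Lemma restr_exists i m pi : (i + m <= degree pi)%N ->
  exists2 tau, degree tau = m & restr i pi tau.
Proof.
move=> im; pose R (u v : vertex m) :=
  conn pi (shift i (point_of u)) (shift i (point_of v)).
have eqR : {in [set: vertex m]%SET & &, equivalence_rel R}.
  move=> u v w _ _ _; split=> [|uv].
    by rewrite /R conn_refl /= (leq_trans _ im) // ltn_add2l point_of_lt.
  by apply/idP/idP; apply: conn_trans; rewrite // conn_sym.
have pR : is_diagram (equivalence_partition R [set: vertex m]%SET).
  exact: equivalence_partitionP.
exists (mk_pdiagram pR) => //; split=> // x y /point_ofP[u ->] /point_ofP[v ->].
rewrite (@conn_point (mk_pdiagram pR)) joined_pblock //=.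
by rewrite pblock_equivalence_partition ?inE.
Qed.

Lemma restr_uniq i pi tau tau' :
  restr i pi tau -> restr i pi tau' -> degree tau = degree tau' -> tau = tau'.
Proof.
move=> [_ h] [_ h'] e; apply: pdiagram_ext => // x y xt yt.
by rewrite h // h' -?e.
Qed.

Lemma restr_trans i j pi tau tau' :
  restr i pi tau -> restr j tau tau' -> restr (i + j) pi tau'.
Proof.
move=> [le h] [le' h']; split=> [|x y xt yt]; first lia.
rewrite h' // h /=; [|lia..].
by rewrite /shift /= !addnA.
Qed.

(** This turns equations between products into statements about windows and cuts of a single
    diagram, where they can be moved and restricted. *)
Lemma opP a pi rho sigma : (0 < degree rho)%N -> (0 < degree sigma)%N ->
  pi = op a rho sigma <->
  [/\ degree pi = (degree rho + degree sigma)%N, restr 0 pi rho,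
      restr (degree rho) pi sigma & cut a (degree rho) pi].
Proof.
move=> k0 m0; split=> [->|[e [_ r0] [_ r1] c]].
  split=> [|||x y xk ky yl].
  - exact: degree_op.
  - split=> [|[x1 x2] [y1 y2] /= xk yk]; first by rewrite degree_op leq_addr.
    by rewrite conn_op //= xk yk.
  - split=> [|x y xk yk]; first by rewrite degree_op.
    by rewrite conn_op //= !ltnNge !leq_addr !shiftK.
  - rewrite !conn_op //= xk ltnNge ky /= ltnn prednK // leqnn.
    by rewrite {2}/unshift /= subnn.
apply: pdiagram_ext; first by rewrite degree_op.
(* Connections inside the left part, inside the right part and across the cut are each fixed by one
   hypothesis; symmetry gives the remaining case. *)
have rE x y : (x.1 < degree rho)%N -> (y.1 < degree rho)%N ->
    conn pi x y = conn rho x y.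
  by case: x y => [x1 x2] [y1 y2] xk yk; rewrite r0.
have sE x y : (degree rho <= x.1 < degree pi)%N -> (degree rho <= y.1 < degree pi)%N ->
    conn pi x y = conn sigma (unshift (degree rho) x) (unshift (degree rho) y).
  move=> /andP[xk xp] /andP[yk yp].
  by rewrite r1 ?unshiftK //=; lia.
have cE x y : (x.1 < degree rho)%N -> (degree rho <= y.1 < degree pi)%N ->
    conn pi x y = [&& ~~ a, conn rho x ((degree rho).-1, true)
      & conn sigma (0%N, true) (unshift (degree rho) y)].
  move=> xk /andP[yk yp]; rewrite c // rE //=; last lia.
  rewrite sE /=; [|lia..].
  by rewrite {1}/unshift /= subnn.
move=> x y xp yp; rewrite conn_op //.
case: (ltnP x.1) => xk; case: (ltnP y.1) => yk.
- exact: rE.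
- by rewrite cE // yk.
- by rewrite conn_sym cE // xk.
- by rewrite sE ?xk ?yk.
Qed.

Lemma op_inj a b rho sigma rho' sigma' :
  (0 < degree rho)%N -> (0 < degree sigma)%N -> (0 < degree sigma')%N ->
  degree rho = degree rho' -> op a rho sigma = op b rho' sigma' ->
  [/\ a = b, rho = rho' & sigma = sigma'].
Proof.
move=> k0 m0 m0' e eq_op; set pi := op a rho sigma in eq_op.
have k0' : (0 < degree rho')%N by rewrite -e.
have [ord r0 r1 c] := (@opP a pi rho sigma k0 m0).1 erefl.
have [ord' r0' r1' c'] := (@opP b pi rho' sigma' k0' m0').1 eq_op.
rewrite -e in ord' r1' c'.
split; last 2 first.
- exact: restr_uniq r0 r0' e.
- by apply: restr_uniq r1 r1' _; lia.
(* The two primed vertices next to the cut are connected for [bullet] and not for [tensor], so they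
   reveal the operation. *)
have := c ((degree rho).-1, true) (degree rho, true).
rewrite c' /= ?conn_refl /=; [|lia..].
have -> : ((degree rho).-1 < degree pi)%N by lia.
have -> : (degree rho < degree pi)%N by lia.
by rewrite !andbT => /(_ _ _ _)/negb_inj->//; lia.
Qed.

Lemma restr_sub i j pi tau tau' : restr i pi tau -> restr j pi tau' ->
  (i <= j)%N -> (j + degree tau' <= i + degree tau)%N -> restr (j - i) tau tau'.
Proof.
move=> [_ h] [_ h'] ij le; split=> [|x y xt yt]; first lia.
rewrite h' // h /=; [|lia..].
by rewrite /shift /= !addnA subnKC.
Qed.

Lemma restr_cut a i j pi tau :
  restr i pi tau -> cut a (i + j) pi -> (0 < j)%N -> cut a j tau.
Proof.
move=> [le h] c j0 x y xj jy yt.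
rewrite !h /=; [|lia..].
rewrite c /=; [|lia..].
(* As [j] is positive, column [j.-1] of the window is column [(i + j).-1] of [pi]. *)
by rewrite /shift /= -subn1 -addnBA // subn1.
Qed.

(** The diagram [tau] is the window between the two cuts. The first cut remains a cut inside [rho'],
    and the second one inside [sigma]. *)
Lemma op_levi a b rho sigma rho' sigma' :
  (0 < degree rho)%N -> (0 < degree sigma)%N -> (0 < degree sigma')%N ->
  (degree rho < degree rho')%N -> op a rho sigma = op b rho' sigma' ->
  exists tau, [/\ (0 < degree tau)%N, rho' = op a rho tau & sigma = op b tau sigma'].
Proof.
move=> k0 m0 m0' lt eq_op; set pi := op a rho sigma in eq_op.
have k0' : (0 < degree rho')%N by lia.
have [ord r0 r1 c] := (@opP a pi rho sigma k0 m0).1 erefl.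
have [ord' r0' r1' c'] := (@opP b pi rho' sigma' k0' m0').1 eq_op.
have [|tau otau rtau] := @restr_exists (degree rho) (degree rho' - degree rho) pi.
  lia.
exists tau; rewrite otau subn_gt0; split=> //.
- apply/opP; rewrite ?otau ?subn_gt0 //; split; first lia.
  + by apply: restr_sub r0' r0 _ _ => //; lia.
  + by rewrite -[degree rho]subn0; apply: restr_sub r0' rtau _ _ => //; lia.
  + exact: restr_cut r0' c k0.
- have e : (degree rho + (degree rho' - degree rho) = degree rho')%N by lia.
  apply/opP; rewrite ?otau ?subn_gt0 //; split; first lia.
  + by rewrite -(subnn (degree rho)); apply: restr_sub r1 rtau _ _ => //; lia.
  + by apply: restr_sub r1 r1' _ _; lia.
  + by apply: restr_cut r1 _ _; rewrite ?e ?subn_gt0.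
Qed.

Lemma op_assoc a b x y z :
  (0 < degree x)%N -> (0 < degree y)%N -> (0 < degree z)%N ->
  op b (op a x y) z = op a x (op b y z).
Proof.
move=> x0 y0 z0; move ew : (op a x y) => w; move epi : (op b w z) => pi.
have [ow wx wy cw] := (@opP a w x y x0 y0).1 (esym ew).
have w0 : (0 < degree w)%N by lia.
have [opi pw pz cpi] := (@opP b pi w z w0 z0).1 (esym epi).
have px : restr 0 pi x := restr_trans pw wx.
have py : restr (degree x) pi y := restr_trans pw wy.
have conn_w u v : (u.1 < degree w)%N -> (v.1 < degree w)%N ->
    conn pi u v = conn w u v.
  by case: u v pw => [? ?] [? ?] [_ h] uw vw; rewrite h.
(* The cut of [w] after [x] is also a cut of [pi]: a connection from [x] to [z] first passes the cut
   after [w], through the last primed vertex of [w]. That vertex lies to the right of [x] because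
   [y] is non-empty, so [cw] applies to it. *)
have cx : cut a (degree x) pi.
  move=> u v ux xv vp; have [vw|wv] := ltnP v.1 (degree w).
    rewrite !(conn_w u) /=; [|lia..].
    rewrite (conn_w (_, true)) /=; [|lia..].
    exact: cw.
  rewrite [LHS]cpi // 1?(cpi (degree x, true)) //=; [|lia..].
  rewrite (conn_w u (_.-1, true)) /=; [|lia..].
  rewrite (conn_w u) /=; [|lia..].
  rewrite (conn_w (_, true) (_.-1, true)) /=; [|lia..].
  rewrite (cw u) /=; [|lia..].
  by case: a b {ew epi ow wx wy cw w0 opi pw pz cpi px py conn_w vp wv xv ux}
    => [] [] //=; rewrite ?andbF //= -andbA.
have [|tau otau ptau] := @restr_exists (degree x) (degree y + degree z) pi.
  lia.
have tau0 : (0 < degree tau)%N by lia.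
have -> : pi = op a x tau.
  by apply/opP => //; split=> //; lia.
congr op; apply/opP => //; split=> //.
- by rewrite -(subnn (degree x)); apply: restr_sub ptau py _ _ => //; lia.
- have -> : degree y = (degree w - degree x)%N by lia.
  by apply: restr_sub ptau pz _ _; lia.
- by apply: restr_cut ptau _ y0; rewrite -ow.
Qed.

(** * Unit and associativity of the tensor product *)

Lemma tensor_empty pi : tensor pi empty_diagram = pi.
Proof.
apply: pdiagram_ext => [|x y]; first by rewrite (degree_op true) addn0.
rewrite (degree_op true) /= addn0 => xk yk.
by rewrite conn_tensor xk yk.
Qed.

Lemma degree_tensor rho sigma :
  degree (tensor rho sigma) = (degree rho + degree sigma)%N.
Proof. exact: (degree_op true). Qed.

Lemma degree_bullet rho sigma :
  degree (bullet rho sigma) = (degree rho + degree sigma)%N.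
Proof. exact: (degree_op false). Qed.

Lemma tensor_empty_l pi : tensor empty_diagram pi = pi.
Proof.
apply: pdiagram_ext => [|[x1 x2] [y1 y2] _ _]; first exact: (degree_op true).
by rewrite conn_tensor /unshift /= !subn0.
Qed.

Lemma tensorA : associative tensor.
Proof.
have ne x : (0 < degree x)%N \/ x = empty_diagram.
  by have [/degree_eq0|] := posnP (degree x); [right|left].
move=> x y z; case: (ne x) => [x0|->]; last by rewrite !tensor_empty_l.
case: (ne y) => [y0|->]; last by rewrite tensor_empty_l tensor_empty.
case: (ne z) => [z0|->]; last by rewrite !tensor_empty.
exact: esym (op_assoc true true x0 y0 z0).
Qed.

(** * Unique factorization *)

Definition op_irreducible (b : bool) : pdiagram -> Prop :=
  if b then tensor_irreducible else bullet_irreducible.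

Lemma op_irreducibleP b pi rho sigma : op_irreducible b pi ->
  (0 < degree rho)%N -> (0 < degree sigma)%N -> pi <> op b rho sigma.
Proof.
by move=> irr /degree_gt0 ? /degree_gt0 ?; case: b irr => irr e; apply: irr;
  exists rho, sigma.
Qed.

(** By [op_levi] the longer left factor would split, with the operation of the other product. This
    is why [x] is irreducible for [b] and [y] for [a]. *)
Lemma op_eq_degree_l a b x P y Q :
  (0 < degree x)%N -> (0 < degree P)%N -> (0 < degree y)%N -> (0 < degree Q)%N ->
  op_irreducible b x -> op_irreducible a y ->
  op a x P = op b y Q -> degree x = degree y.
Proof.
move=> x0 P0 y0 Q0 ix iy e; case: (ltngtP (degree x) (degree y)) => // lt.
  have [tau [t0 ey _]] := op_levi x0 P0 Q0 lt e.
  by case: (op_irreducibleP iy x0 t0 ey).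
have [tau [t0 ex _]] := op_levi y0 Q0 P0 lt (esym e).
by case: (op_irreducibleP ix y0 t0 ex).
Qed.

Lemma op_eq_degree_r a b x P y Q :
  (0 < degree x)%N -> (0 < degree P)%N -> (0 < degree y)%N -> (0 < degree Q)%N ->
  op_irreducible b x -> op_irreducible a y ->
  op a P x = op b Q y -> degree P = degree Q.
Proof.
move=> x0 P0 y0 Q0 ix iy e; case: (ltngtP (degree P) (degree Q)) => // lt.
  have [tau [t0 _ ex]] := op_levi P0 x0 y0 lt e.
  by case: (op_irreducibleP ix t0 y0 ex).
have [tau [t0 _ ey]] := op_levi Q0 y0 x0 lt (esym e).
by case: (op_irreducibleP iy t0 x0 ey).
Qed.

Definition irreducible (pi : pdiagram) : Prop :=
  [/\ pi <> empty_diagram, tensor_irreducible pi & bullet_irreducible pi].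

Lemma irreducible_op b pi : irreducible pi -> op_irreducible b pi.
Proof. by case: b => -[]. Qed.

Lemma irreducible_gt0 pi : irreducible pi -> (0 < degree pi)%N.
Proof. by case=> /degree_gt0. Qed.

(** Strong induction on the order: a reducible right factor is split again, and [op_assoc] moves its
    left part into [rho]. Splitting off the last factor matches the left nesting of [op_product]. *)
Lemma irreducible_or_op pi : (0 < degree pi)%N -> irreducible pi \/
  exists a rho sigma, [/\ (0 < degree rho)%N, irreducible sigma & pi = op a rho sigma].
Proof.
have [n] := ubnP (degree pi); elim: n pi => // n IH pi ltn pi0.
have [|nirr] := pselect (irreducible pi); [by left|right].
have [a [rho [sigma [r0 s0 e]]]] : exists a rho sigma,
    [/\ (0 < degree rho)%N, (0 < degree sigma)%N & pi = op a rho sigma].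
  apply: contrapT => h; apply: nirr; split; first exact/degree_gt0.
    by case=> rho [sigma [/degree_gt0 ? /degree_gt0 ? e]]; apply: h;
      exists true, rho, sigma.
  by case=> rho [sigma [/degree_gt0 ? /degree_gt0 ? e]]; apply: h;
    exists false, rho, sigma.
have [|//|irr|[b [u [v [u0 irr es]]]]] := IH sigma.
- by move: ltn; rewrite e degree_op; lia.
- by exists a, rho, sigma.
exists b, (op a rho u), v; split=> //; first by rewrite degree_op; lia.
by rewrite e es op_assoc // irreducible_gt0.
Qed.

Lemma op_product_rcons s ops x a : size ops = (size s).-1 -> (0 < size s)%N ->
  op_product (rcons s x) (rcons ops a) = op a (op_product s ops) x.
Proof.
by case: s => //= y s e _; rewrite zip_rcons // foldl_rcons.
Qed.

(** As [op_product] is a left fold, factors and operations are added together at the right end; a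
    single factor is a separate base case since it comes with no operation. *)
Lemma op_product_ind (T : seq pdiagram -> seq bool -> Prop) :
  T [::] [::] -> (forall x, T [:: x] [::]) ->
  (forall s ops x a, size ops = (size s).-1 -> (0 < size s)%N -> T s ops ->
     T (rcons s x) (rcons ops a)) ->
  forall s ops, size ops = (size s).-1 -> T s ops.
Proof.
move=> T0 T1 TS; elim/last_ind => [|s x IH] ops; first by move/size0nil->.
rewrite size_rcons /=; case: s IH => [_ /size0nil->|y s IH] //.
  exact: T1.
case/lastP: ops => // ops a; rewrite size_rcons => -[e].
by apply: TS => //; apply: IH.
Qed.

Lemma degree_op_product s ops : size ops = (size s).-1 ->
  {in s, forall x, irreducible x} -> (0 < size s)%N ->
  (0 < degree (op_product s ops))%N.
Proof.
move=> e; move: e; move: s ops.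
apply: op_product_ind => [//|x /(_ x) h _|s ops x a e s0 IH h _].
  by apply: irreducible_gt0; apply: h; rewrite inE.
rewrite op_product_rcons // degree_op.
suff: (0 < degree (op_product s ops))%N by lia.
by apply: IH => // y ys; apply: h; rewrite mem_rcons inE ys orbT.
Qed.

Lemma in_rcons_irr s x : {in rcons s x, forall y, irreducible y} ->
  irreducible x /\ {in s, forall y, irreducible y}.
Proof.
by move=> h; split=> [|y ys]; apply: h; rewrite mem_rcons inE ?eqxx ?ys ?orbT.
Qed.

(** The last factors are irreducible for both operations, so [op_eq_degree_r] puts the last cuts at
    the same column; [op_inj] then identifies the operations and both sides, and induction continues
    on the left. *)
Lemma op_product_inj s ops s' ops' :
  size ops = (size s).-1 -> size ops' = (size s').-1 ->
  {in s, forall x, irreducible x} -> {in s', forall x, irreducible x} ->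
  op_product s ops = op_product s' ops' -> s = s' /\ ops = ops'.
Proof.
move=> e; move: s ops e s' ops'.
(* An irreducible diagram is not a product of two or more factors; this excludes lists of different
   kinds. *)
have absurd x s ops y a : size ops = (size s).-1 -> (0 < size s)%N ->
    irreducible x -> {in rcons s y, forall y, irreducible y} ->
    x <> op_product (rcons s y) (rcons ops a).
  move=> e s0 ix /in_rcons_irr[iy h]; rewrite op_product_rcons //.
  apply: op_irreducibleP; first exact: irreducible_op.
    exact: degree_op_product.
  exact: irreducible_gt0.
apply: op_product_ind => [|x|s ops x a e s0 IH] s' ops' e'; move: s' ops' e'.
- move=> s' ops' e' _ h E.
  have [s'0|/(degree_op_product e' h)] := posnP (size s'); last by rewrite -E.
  by move: e'; rewrite (size0nil s'0) => /size0nil->.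
- apply: op_product_ind => [h _ /esym E|y _ _ /= -> //|t ops y b e t0 _ h h'].
    have /irreducible_gt0 := h x (mem_head _ _).
    by rewrite -[degree x](congr1 degree E).
  by move=> E; case: (absurd x t ops y b) => //; apply: h; rewrite inE.
apply: op_product_ind => [h _ E|y h h' E|t ops' y b e' t0 _ h h'].
- have := @degree_op_product (rcons s x) (rcons ops a) _ h.
  by rewrite E !size_rcons e prednK // => /(_ erefl isT).
- by case: (absurd y s ops x a) => //; apply: h'; rewrite inE.
have [ix hs] := in_rcons_irr h; have [iy ht] := in_rcons_irr h'.
have [x0 y0] := (irreducible_gt0 ix, irreducible_gt0 iy).
have s'0 := degree_op_product e hs s0; have t'0 := degree_op_product e' ht t0.
rewrite !op_product_rcons // => E.
have dE := op_eq_degree_r x0 s'0 y0 t'0 (irreducible_op b ix) (irreducible_op a iy) E.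
have [-> /(IH _ _ e' hs ht)[-> ->] ->] := op_inj s'0 x0 y0 dE E.
by [].
Qed.

Lemma refinement_exists pi : exists w, refinement pi w.
Proof.
have [n] := ubnP (degree pi); elim: n pi => // n IH pi ltn.
have [/degree_eq0->|pi0] := posnP (degree pi); first by exists ([::], [::]).
case: (irreducible_or_op pi0) => [irr|[a [rho [sigma [r0 irr e]]]]].
  by exists ([:: pi], [::]); split=> //= rho; rewrite inE => /eqP->.
have s0 := irreducible_gt0 irr.
have [|[s ops] [/= hs es ew]] := IH rho; first by move: ltn; rewrite e degree_op; lia.
have sz : (0 < size s)%N by case: s ew {hs es} => // er; rewrite er in r0.
exists (rcons s sigma, rcons ops a); split=> /=.
- by move=> x; rewrite mem_rcons inE => /predU1P[->|/hs].
- by rewrite !size_rcons es prednK.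
- by rewrite op_product_rcons // -ew.
Qed.

Lemma refinement_refine pi : refinement pi (refine pi).
Proof. exact: xgetPex (refinement_exists pi). Qed.

Lemma refine_op_product s ops : size ops = (size s).-1 ->
  {in s, forall x, irreducible x} -> refine (op_product s ops) = (s, ops).
Proof.
move=> e h; have [/= h' e' E] := refinement_refine (op_product s ops).
have [] := op_product_inj e e' h h' E.
by case: (refine _) => /= ? ? -> ->.
Qed.

(** * Tensor factorizations and their length *)

Lemma tensor_product_gt0 s : (forall x, x \in s -> x <> empty_diagram) ->
  (0 < size s)%N -> (0 < degree (foldr tensor empty_diagram s))%N.
Proof.
case: s => // x s h _; have /degree_gt0 x0 := h x (mem_head _ _).
by rewrite [foldr _ _ _]/= degree_tensor ltn_addr.
Qed.

Lemma tensor_product_inj s t :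
  (forall x, x \in s -> x <> empty_diagram /\ tensor_irreducible x) ->
  (forall x, x \in t -> x <> empty_diagram /\ tensor_irreducible x) ->
  foldr tensor empty_diagram s = foldr tensor empty_diagram t -> s = t.
Proof.
elim: s t => [|x s IH] [|y t] // hs ht.
- move=> E; have := @tensor_product_gt0 (y :: t) (fun x xt => (ht x xt).1) isT.
  by rewrite -E.
- move=> E; have := @tensor_product_gt0 (x :: s) (fun x xt => (hs x xt).1) isT.
  by rewrite E.
have [/degree_gt0 x0 ix] := hs x (mem_head _ _).
have [/degree_gt0 y0 iy] := ht y (mem_head _ _).
have {}hs z : z \in s -> z <> empty_diagram /\ tensor_irreducible z.
  by move=> zs; apply: hs; rewrite inE zs orbT.
have {}ht z : z \in t -> z <> empty_diagram /\ tensor_irreducible z.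
  by move=> zs; apply: ht; rewrite inE zs orbT.
have s0 := @tensor_product_gt0 s (fun x xt => (hs x xt).1).
have t0 := @tensor_product_gt0 t (fun x xt => (ht x xt).1).
(* An empty tail has an empty product, to which the lemmas on [op] do not apply, so these cases are
   separate. *)
rewrite /=; case: s t hs ht s0 t0 IH => [|x' s] [|y' t] hs ht s0 t0 IH.
- by rewrite /= !tensor_empty => ->.
- rewrite [foldr _ _ [::]]/= tensor_empty => E.
  by case: (@op_irreducibleP true _ _ _ ix y0 (t0 isT) E).
- rewrite [foldr _ _ [::]]/= tensor_empty => /esym E.
  by case: (@op_irreducibleP true _ _ _ iy x0 (s0 isT) E).
move=> E.
have dE := @op_eq_degree_l true true _ _ _ _ x0 (s0 isT) y0 (t0 isT) ix iy E.
by have [_ -> /(IH _ hs ht)->] := @op_inj true true _ _ _ _ x0 (s0 isT) (t0 isT) dE E.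
Qed.

Lemma tensor_lengthP pi s : tensor_factorization pi s -> tensor_length pi = size s.
Proof.
move=> fs; have [hs es] := fs.
have [ht et] := xgetPex [::] (ex_intro [set s | tensor_factorization pi s]%classic s fs).
by congr size; apply: tensor_product_inj; rewrite -?es.
Qed.

Lemma tensor_product_rcons s x : foldr tensor empty_diagram (rcons s x) =
  tensor (foldr tensor empty_diagram s) x.
Proof.
elim: s => [|y s IH] /=; first by rewrite tensor_empty tensor_empty_l.
by rewrite IH tensorA.
Qed.

(** A tensor cut away from the junction would, by [op_levi], split [x] or [y]; at the junction the
    operation would be both [tensor] and [bullet]. *)
Lemma bullet_tensor_irreducible x y : (0 < degree x)%N -> (0 < degree y)%N ->
  tensor_irreducible x -> tensor_irreducible y -> tensor_irreducible (bullet x y).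
Proof.
move=> x0 y0 ix iy [u [v [/degree_gt0 u0 /degree_gt0 v0 E]]].
have {}E : op false x y = op true u v by [].
case: (ltngtP (degree x) (degree u)) => [lt|lt|dE].
- have [tau [t0 _ ey]] := op_levi x0 y0 v0 lt E.
  exact: (@op_irreducibleP true _ _ _ iy t0 v0 ey).
- have [tau [t0 ex _]] := op_levi u0 v0 y0 lt (esym E).
  exact: (@op_irreducibleP true _ _ _ ix u0 t0 ex).
- by have [] := op_inj x0 y0 v0 dE E.
Qed.

(** Reading from the left, each [tensor] opens a new tensor factor and each [bullet] enlarges the
    last one. The first summand counts the initial factor, absent for the empty diagram. *)
Lemma tensor_length_op_product s ops : size ops = (size s).-1 ->
  {in s, forall x, irreducible x} ->
  tensor_length (op_product s ops) = ((0 < size s) + count id ops)%N.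
Proof.
move=> e h; suff [t ft <-] : exists2 t, tensor_factorization (op_product s ops) t
    & size t = ((0 < size s) + count id ops)%N by exact: tensor_lengthP.
move: s ops e h; apply: op_product_ind => [_|x h|s ops x a e s0 IH].
- by exists [::].
- exists [:: x] => //; split=> [y|]; last by rewrite /= tensor_empty.
  by rewrite inE => /eqP->; have [] := h x (mem_head _ _).
case/in_rcons_irr => irx hs; have x0 := irreducible_gt0 irx.
have P0 := degree_op_product e hs s0.
have [t [ht et] st] := IH hs.
rewrite op_product_rcons // size_rcons -cats1 count_cat /= addn0.
case: a => /=.
  exists (rcons t x); last by rewrite size_rcons st s0 addn1 addnS.
  split=> [y|]; last by rewrite tensor_product_rcons et.
  by rewrite mem_rcons inE => /predU1P[->|/ht //]; case: irx.
(* Here the operation is [bullet]: [x] is absorbed into the last tensor factor [y], which exists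
   because the product so far is non-empty. *)
case/lastP: t ht et st => [_ E|t y ht et st]; first by rewrite E in P0.
have [/degree_gt0 y0 iy] : y <> empty_diagram /\ tensor_irreducible y.
  by apply: ht; rewrite mem_rcons mem_head.
exists (rcons t (bullet y x)); last first.
  by rewrite size_rcons -(size_rcons t y) st s0 addn0.
split=> [z|].
  rewrite mem_rcons inE => /predU1P[->|zt]; last first.
    by apply: ht; rewrite mem_rcons inE zt orbT.
  split; first by apply/degree_gt0; rewrite degree_bullet; lia.
  by apply: bullet_tensor_irreducible => //; case: irx.
rewrite et !tensor_product_rcons.
have [/degree_eq0->|T0] := posnP (degree (foldr tensor empty_diagram t)).
  by rewrite !tensor_empty_l.
exact: (op_assoc true false).
Qed.

(** * Expansions over a similarity class *)

Lemma mem_interval1 k i : (i \in interval1 k) = (0 < i <= k)%N.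
Proof. by rewrite in_fset mem_iota add1n ltnS. Qed.

Lemma mem_tensor_set pi i : (i \in tensor_set pi) =
  (i \in interval1 (size (factors pi)).-1) && nth false (refine pi).2 i.-1.
Proof. by rewrite in_fset. Qed.

Section SimilarDiagrams.

Variables (s : seq pdiagram) (s_irr : {in s, forall x, irreducible x}).
Local Notation m := (size s).-1.

(** Position [i] of [f], counted from 0, is the element [i.+1] of [[n-1]]. For empty [s] there is
    just one map, and its word is the empty diagram. *)
Definition word (f : {ffun 'I_m -> bool}) : pdiagram := op_product s (codom f).

Lemma refine_word f : refine (word f) = (s, codom f).
Proof. by apply: refine_op_product; rewrite // size_codom card_ord. Qed.

Lemma factors_word f : factors (word f) = s.
Proof. by rewrite /factors refine_word. Qed.

Lemma word_inj : injective word.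
Proof.
move=> f g /(congr1 (fun x => (refine x).2)); rewrite !refine_word /= => E.
by apply/ffunP => i; move: E => /eq_in_map; apply; rewrite mem_enum.
Qed.

Lemma wordP pi : factors pi = s -> exists f, pi = word f.
Proof.
move=> e; have [_ sz ->] := refinement_refine pi.
rewrite -/(factors pi) e in sz *.
exists [ffun i : 'I_m => nth false (refine pi).2 i]; congr op_product.
apply: (@eq_from_nth _ false); first by rewrite size_codom card_ord.
rewrite sz => i im; rewrite (nth_map (Ordinal im)); last by rewrite size_enum_ord.
by rewrite ffunE nth_enum_ord.
Qed.

Lemma tensor_set_sub f : (tensor_set (word f) `<=` interval1 m)%fset.
Proof.
by apply/fsubsetP => i; rewrite mem_tensor_set factors_word => /andP[].
Qed.

Lemma in_tensor_set f (i : 'I_m) : (i.+1 \in tensor_set (word f)) = f i.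
Proof.
rewrite mem_tensor_set factors_word refine_word mem_interval1 /= ltn_ord.
by rewrite (nth_map i) ?size_enum_ord // nth_ord_enum.
Qed.

Lemma in_interval1 (i : 'I_m) : i.+1 \in interval1 m.
Proof. by rewrite mem_interval1 /= ltn_ord. Qed.

Lemma sim_word f g : sim (word f) (word g).
Proof. by rewrite /sim !factors_word. Qed.

Lemma refines_word f g : refines (word f) (word g) <-> [forall i, g i ==> f i].
Proof.
split=> [[_ /fsubsetP h]|/forallP h].
  by apply/forallP => i; apply/implyP; rewrite -!in_tensor_set; exact: h.
split=> [|]; first exact: sim_word.
apply/fsubsetP => -[|i] it; have := fsubsetP (tensor_set_sub g) _ it;
  rewrite mem_interval1 //= => im.
have := h (Ordinal im); rewrite -!in_tensor_set => /implyP; exact.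
Qed.

(** By [wordP] and [word_inj], the maps [f] list the similarity class without repetition, so sums
    over sets of diagrams become ordinary finite sums. *)
Lemma sum_word (V : zmodType) (A : classical_sets.set pdiagram) (F : pdiagram -> V) :
  (forall sigma, A sigma -> factors sigma = s) ->
  \sum_(sigma \in A) F sigma = \sum_(f | word f \in A) F (word f).
Proof.
move=> As; set r := [seq f <- index_enum {ffun 'I_m -> bool} | word f \in A].
rewrite (fsbigE (map word r)).
- rewrite big_map big_filter_cond; apply: eq_bigl => f; exact: andbb.
- by rewrite (map_inj_uniq word_inj) filter_uniq ?index_enum_uniq.
- by move=> sigma /mapP[f]; rewrite mem_filter => /andP[/set_mem fA _] ->.
move=> sigma sA; have [f e] := wordP (As _ sA).
move/negP; case; rewrite e in sA *; apply: map_f.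
by rewrite mem_filter mem_index_enum mem_set.
Qed.

(** A power counting positions becomes a product with one factor per position, as needed for entries
    of a tensor power. *)
Lemma prod_interval1 (R : comPzRingType) (x : R) (A : {fset nat}) :
  (A `<=` interval1 m)%fset ->
  x ^+ #|` A|%fset = \prod_(i < m) (if i.+1 \in A then x else 1).
Proof.
move=> sA.
transitivity (\prod_(1 <= i < m.+1) (if i \in A then x else 1)); last first.
  by rewrite big_add1 big_mkord.
rewrite -big_mkcond /= -big_filter /index_iota subn1 /=.
rewrite (perm_big (enum_fset A)) /=; last first.
  apply: uniq_perm; rewrite ?filter_uniq ?iota_uniq // => i.
  rewrite mem_filter mem_iota add1n ltnS; apply: andb_idr => /(fsubsetP sA).
  by rewrite mem_interval1.
by rewrite big_const_seq count_predT iter_mulr_1.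
Qed.

End SimilarDiagrams.

(** * Tensor powers of 2x2 matrices *)

Lemma prod_if (R : comPzRingType) (I : finType) (P : pred I) (F : I -> R) :
  \prod_i (if P i then F i else 0) = if [forall i, P i] then \prod_i F i else 0.
Proof.
case: ifPn => [/forallP h|/forallPn[i ni]].
  by apply: eq_bigr => i _; rewrite h.
by rewrite (bigD1 i) //= (negPf ni) mul0r.
Qed.

(** The matrix from [L] to [M] at one position: [a] is the operation in the index of [L], [b] the
    one in the index of [M]. *)
Definition L_entry (K : fieldType) (a b : bool) : K := if a ==> b then 1 else 0.

(** The same for [eta]. Each tensor in the index of [M] contributes one [r]; the [r] for the initial
    tensor factor is kept outside. *)
Definition eta_entry (K : fieldType) (r : K) (a b : bool) : K :=
  if b ==> a then (if b then r else 1) else 0.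

(** The composite of two tensor powers is the tensor power of the 2x2 product, by distributing the
    product over positions across the sum over [h]. *)
Lemma sum_prod_entries (K : fieldType) (V : lmodType K) (m : nat)
    (c d : bool -> bool -> K) (M : {ffun 'I_m -> bool} -> V)
    (g : {ffun 'I_m -> bool}) :
  \sum_(h : {ffun 'I_m -> bool}) (\prod_i c (g i) (h i)) *:
     (\sum_(f : {ffun 'I_m -> bool}) (\prod_i d (h i) (f i)) *: M f) =
  \sum_(f : {ffun 'I_m -> bool})
     (\prod_i (c (g i) true * d true (f i) + c (g i) false * d false (f i))) *: M f.
Proof.
under eq_bigr do rewrite scaler_sumr.
rewrite exchange_big; apply: eq_bigr => f _ /=.
under eq_bigr do rewrite scalerA -big_split.
rewrite -scaler_suml; congr (_ *: _).
rewrite -(bigA_distr_bigA (fun i b => c (g i) b * d b (f i))) /=.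
by apply: eq_bigr => i _; rewrite big_bool.
Qed.

(** * The families L and eta in the basis M *)

Section Expansions.

Variables (K : fieldType) (r : K).
Variables (s : seq pdiagram) (s_irr : {in s, forall x, irreducible x}).
Local Notation m := (size s).-1.
Local Notation word := (@word s).

Lemma word_in_refines (f g : {ffun 'I_m -> bool}) :
  (word f \in [set sigma | refines sigma (word g)]%classic) =
  [forall i, g i ==> f i].
Proof.
by apply/idP/idP => [/set_mem /(refines_word s_irr)|/(refines_word s_irr)/mem_set].
Qed.

Lemma word_in_coarsens (f g : {ffun 'I_m -> bool}) :
  (word f \in [set sigma | refines (word g) sigma]%classic) =
  [forall i, f i ==> g i].
Proof.
by apply/idP/idP => [/set_mem /(refines_word s_irr)|/(refines_word s_irr)/mem_set].
Qed.

Lemma L_basis_word (g : {ffun 'I_m -> bool}) :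
  L_basis K (word g) =
  \sum_(f : {ffun 'I_m -> bool}) (\prod_i L_entry K (g i) (f i)) *: M_basis K (word f).
Proof.
rewrite /L_basis (sum_word s_irr) => [|sigma [e _]]; last first.
  by rewrite e factors_word.
rewrite big_mkcond; apply: eq_bigr => f _.
rewrite word_in_refines prod_if big1_eq.
by case: ifP; rewrite ?scale1r ?scale0r.
Qed.

Lemma eta_word (g : {ffun 'I_m -> bool}) :
  eta r (word g) = r ^+ (0 < size s)%N *:
  \sum_(f : {ffun 'I_m -> bool}) (\prod_i eta_entry r (g i) (f i)) *: M_basis K (word f).
Proof.
rewrite /eta (sum_word s_irr) => [|sigma [e _]]; last first.
  by rewrite -e factors_word.
rewrite big_mkcond scaler_sumr; apply: eq_bigr => f _.
rewrite word_in_coarsens prod_if scalerA.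
case: ifP; last by rewrite mulr0 scale0r.
rewrite tensor_length_op_product // ?size_codom ?card_ord // exprD => _.
rewrite count_map -big_mkcond prodr_const -sum1_card -sum1_count big_enum_cond.
by congr ((_ * r ^+ _) *: _); apply: eq_bigl.
Qed.

Lemma sum_sim_word (V : zmodType) (F : pdiagram -> V) (g : {ffun 'I_m -> bool}) :
  \sum_(rho \in [set rho | sim rho (word g)]%classic) F rho =
  \sum_(f : {ffun 'I_m -> bool}) F (word f).
Proof.
rewrite (sum_word s_irr) => [|sigma e]; last by rewrite e factors_word.
by apply: eq_bigl => f; apply/mem_set/sim_word.
Qed.

End Expansions.

(* The first formula needs a non-empty diagram: for the empty one its two sides
   are M_empty and r M_empty. *)
Theorem proposition9p1 (K : fieldType) (r : K) (hr : r \is a GRing.unit) :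
  let q := r - 1 in
  (forall pi : pdiagram, pi <> empty_diagram ->
     eta r pi =
       r *: \sum_(rho \in [set rho | sim rho pi]%classic)
              ((-1) ^+ #|` (tensor_set rho `\` tensor_set pi)%fset|
               * q ^+ #|` (tensor_set rho `&` tensor_set pi)%fset|) *: L_basis K rho)
  /\
  (forall (n : nat) (pi : pdiagram), in_I n pi ->
     L_basis K pi =
       r ^- n *: \sum_(rho \in [set rho | sim rho pi]%classic)
              ((-1) ^+ #|` (tensor_set pi `\` tensor_set rho)%fset|
               * q ^+ #|` (interval1 n.-1 `\` (tensor_set rho `|` tensor_set pi))%fset|)
              *: eta r rho).
Proof.
move=> q; split=> [pi ne|n pi <-].
  have irr : {in factors pi, forall x, irreducible x}.
    by have [h _ _] := refinement_refine pi.
  (* Non-emptiness makes the outer power of [r] in [eta_word] equal to [r] itself. *)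
  have s0 : (0 < size (factors pi))%N.
    rewrite lt0n; apply/eqP => /size0nil e; apply: ne.
    by have [_ _ ->] := refinement_refine pi; rewrite -/(factors pi) e.
  have [g e] := wordP (erefl (factors pi)).
  move: (factors pi) irr s0 g e => s irr s0 g ->.
  rewrite eta_word // s0 expr1 sum_sim_word //; congr (_ *: _).
  (* At a position where [rho] has a tensor the coefficient contributes [q] or [-1], according to
     whether [pi] has one too; elsewhere it contributes 1. *)
  rewrite [RHS](eq_bigr (fun h : {ffun 'I_(size s).-1 -> bool} =>
    (\prod_i (if h i then if g i then q else -1 else 1)) *:
    \sum_(f : {ffun 'I_(size s).-1 -> bool})
      (\prod_i L_entry K (h i) (f i)) *: M_basis K (word f))); last first.
    move=> h _; rewrite L_basis_word //; congr (_ *: _).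
    have sub := fsubset_trans _ (tensor_set_sub irr h).
    rewrite !(prod_interval1 (s := s)) ?sub ?fsubsetDl ?fsubsetIl //.
    rewrite -big_split; apply: eq_bigr => i _ /=.
    rewrite in_fsetD in_fsetI !in_tensor_set //.
    by case: (h i); case: (g i); rewrite ?mul1r ?mulr1.
  rewrite (sum_prod_entries (fun a b => if b then if a then q else -1 else 1)
     (@L_entry K)).
  apply: eq_bigr => f _; congr (_ *: _); apply: eq_bigr => i _.
  (* The four entries of a 2x2 product; the one with two tensors is [q + 1 = r]. *)
  by rewrite /L_entry /eta_entry /q; case: (g i); case: (f i) => /=; ring.
have irr : {in factors pi, forall x, irreducible x}.
  by have [h _ _] := refinement_refine pi.
have [g e] := wordP (erefl (factors pi)).
move: (factors pi) irr g e => s irr g ->.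
rewrite L_basis_word // sum_sim_word //.
(* At a position where [rho] has no tensor the coefficient contributes [-1] if [pi] has one and [q]
   if not; elsewhere it contributes 1. *)
rewrite [X in _ = _ *: X](eq_bigr (fun h : {ffun 'I_(size s).-1 -> bool} =>
    r ^+ (0 < size s)%N *:
    ((\prod_i (if g i then if h i then 1 else -1 else if h i then 1 else q))
    *: \sum_(f : {ffun 'I_(size s).-1 -> bool})
     (\prod_i eta_entry r (h i) (f i)) *: M_basis K (word f)))); last first.
  move=> h _; rewrite eta_word // scalerA mulrC -scalerA; congr (_ *: (_ *: _)).
  rewrite !(prod_interval1 (s := s)) ?fsubsetDl //; last first.
    exact: fsubset_trans (fsubsetDl _ _) (tensor_set_sub irr g).
  rewrite -big_split; apply: eq_bigr => i _ /=.
  rewrite !in_fsetD in_fsetU in_interval1 !in_tensor_set //.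
  by case: (h i); case: (g i); rewrite /= ?mul1r ?mulr1.
rewrite -scaler_sumr (sum_prod_entries (fun a b =>
   if a then if b then 1 else -1 else if b then 1 else q) (eta_entry r)).
rewrite scalerA scaler_sumr; apply: eq_bigr => f _.
rewrite scalerA; congr (_ *: _).
(* This matrix times that of [eta] is [r] times that of [L], so the positions yield the power of [r]
   with exponent [(size s).-1]. *)
rewrite [X in _ = _ * X](eq_bigr (fun i => r * L_entry K (g i) (f i)))
  => [|i _]; last first.
  by rewrite /L_entry /eta_entry /q; case: (g i); case: (f i) => /=; ring.
rewrite big_split prodr_const card_ord mulrA /= -(mulrA (r ^- _)) -exprD.
(* The outer [r] completes the exponent to [n], cancelling the inverse power. For [n = 0] both
   summands vanish, so the empty diagram is covered here. *)
suff -> : ((0 < size s) + (size s).-1)%N = size s.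
  by rewrite mulVr ?mul1r ?unitrX.
by case: (size s).
Qed.
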